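(* There is an absolute constant $C>0$ such that the following holds. Let $G$ be a graph on $n+1$ vertices, and let $H$ be obtained from $G$ by deleting one vertex. Then $r(G) \leq C\sqrt{n\log n}\cdot r(H)$.
   Context: For a graph $F$, the Ramsey number $r(F)$ is the minimum $N$ such that every two-coloring of the edges of the complete graph $K_N$ contains a monochromatic copy of $F$. Logarithms are to base $2$.
   Formalization: The formal theorem assumes n ≥ 2: for n = 1 the bound is false, since log 1 = 0 makes the right side 0 while r(G) ≥ 2, and for n = 0 log n is undefined. *)

(* Defs.v *)
From mathcomp Require Import all_boot.
From Stdlib Require Import ClassicalEpsilon.
Set Implicit Arguments. Unset Strict Implicit. Unset Printing Implicit Defensive.

(* A red/blue colouring of the edges of K_N: a symmetric function on pairs
   of vertices of 'I_N (values on the diagonal are irrelevant).            *)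
Definition sym_colouring (N : nat) (c : {ffun 'I_N * 'I_N -> bool}) : bool :=
  [forall i, forall j, c (i, j) == c (j, i)].

Definition mono_copy (V : finType) (e : rel V) (N : nat)
    (c : {ffun 'I_N * 'I_N -> bool}) : bool :=
  [exists b : bool, exists f : {ffun V -> 'I_N},
     injectiveb f && [forall x, forall y, e x y ==> (c (f x, f y) == b)]].

Definition ramsey_prop (V : finType) (e : rel V) (N : nat) : bool :=
  [forall c : {ffun 'I_N * 'I_N -> bool}, sym_colouring c ==> mono_copy e c].

(* r(F): the minimum such N (set to 0 if no such N existed; by Ramsey's
   theorem it always exists). *)
Definition ramsey_number (V : finType) (e : rel V) : nat :=
  match excluded_middle_informative (exists N, ramsey_prop e N) with
  | left h => ex_minn h
  | right _ => 0
  end.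

Definition del_vertex_type (V : finType) (v : V) : finType := {x : V | x != v}.
Arguments del_vertex_type : clear implicits.
Definition del_vertex_rel (V : finType) (e : rel V) (v : V)
  : rel (del_vertex_type V v) := fun x y => e (val x) (val y).

(* Main.v *)
(* Let r = r(H) and colour K_(k r), with k of order sqrt(n log n), so that no
   monochromatic G appears.  Half of the vertices form the neighbourhood A of
   some vertex in some colour b, and A contains no H of colour b; hence every
   vertex of A has fewer than r neighbours in A of the other colour, i.e. that
   colour has density O(1/k) in A.  Embedding H greedily in colour b fails, so H
   has a subgraph of minimum degree of order k, and the random colouring gives
   log r >= c k.  A clique argument in the style of Erdős and Szemerédi then
   finds in A either a b-clique of size n or a clique of size n + 1 in the other
   colour, as n is at most of order k (log r) / log k; either one is a
   contradiction. *)
Require Import Defs.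
From mathcomp Require Import all_boot zify.
From Stdlib Require Import ZArith Reals Lra Classical.
(* [Reals] rebinds [^] on nat to [Nat.pow]. *)
From mathcomp Require Import ssrnat.
Set Implicit Arguments. Unset Strict Implicit. Unset Printing Implicit Defensive.

(** * Monochromatic cliques, embedded copies and counting *)

Definition mono_clique (T : finType) (c : rel T) (b : bool) (X : {set T}) :=
  {in X &, forall x y, x != y -> c x y = b}.

Definition embeds (W T : finType) (e : rel W) (c : rel T) (b : bool)
    (S : {set T}) :=
  exists f : W -> T, [/\ injective f, forall x, f x \in S
    & forall x y, e x y -> c (f x) (f y) = b].

Definition nbrs (T : finType) (c : rel T) (b : bool) (x : T) : {set T} :=
  [set y | (y != x) && (c x y == b)].

Lemma embedsS (W T : finType) (e : rel W) (c : rel T) b (S S' : {set T}) :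
  S \subset S' -> embeds e c b S -> embeds e c b S'.
Proof.
by move=> sSS' [f [f_inj fS fe]]; exists f; split=> // x; apply: (subsetP sSS').
Qed.

Lemma card_le_fibers (T U : finType) (g : T -> U) (S : {set T}) k :
  {in S, forall x, #|[set y in S | g y == g x]| <= k} ->
  #|S| <= #|g @: S| * k.
Proof.
move=> fib; rewrite -sum1_card (partition_big_imset g) /= -sum_nat_const.
apply: leq_sum => _ /imsetP[x xS ->].
rewrite sum1_card; apply: leq_trans (fib x xS).
by apply/eq_leq/eq_card => y; rewrite !inE.
Qed.

(** Induction on [t]: a subset of size [t.+1] is a smaller one plus an element of [I], so each step
    multiplies the bound by at most [#|I|.+1]. *)
Lemma card_small_subsets (T : finType) (I : {set T}) t :
  #|[set X : {set T} | (X \subset I) && (#|X| <= t)]| <= #|I|.+1 ^ t.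
Proof.
elim: t => [|t IHt].
  apply: (@leq_trans #|[set (set0 : {set T})]|); last by rewrite cards1.
  apply: subset_leq_card; apply/subsetP => X.
  by rewrite !inE leqn0 cards_eq0 => /andP[].
set F := [set X : {set T} | _ & _] in IHt.
apply: (@leq_trans #|F :|: (fun p => p.1 |: p.2) @: setX I F|).
  apply: subset_leq_card; apply/subsetP => X; rewrite !inE => /andP[XI Xt].
  have [//|Xgt] := leqP #|X| t; first by rewrite XI.
  have /card_gt0P[x xX] : 0 < #|X| by lia.
  apply/orP; right; apply/imsetP; exists (x, X :\ x); last by rewrite setD1K.
  rewrite !inE /= (subsetP XI) // (subset_trans (subsetDl _ _) XI) /=.
  by move: (cardsD1 x X); rewrite xX; lia.
apply: leq_trans (leq_card_setU _ _) _.
have := leq_imset_card (fun p : T * {set T} => p.1 |: p.2) (setX I F).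
rewrite cardsX expnS => le2; apply: leq_trans (leq_add IHt le2) _.
by rewrite mulSn leq_add2l leq_mul2l IHt orbT.
Qed.

(** * The Erdős-Szekeres bound *)

(** Induction on [p] and [q] through the two neighbourhoods of a vertex. The power [q.+1 ^ p]
    replaces the binomial coefficient, and [le_pow] takes the place of Pascal's rule. *)
Lemma erdos_szekeres (T : finType) (c : rel T) b p q (S : {set T}) :
  symmetric c -> q.+1 ^ p <= #|S| ->
  (exists X : {set T}, [/\ X \subset S, #|X| = p.+1 & mono_clique c b X]) \/
  (exists X : {set T}, [/\ X \subset S, #|X| = q.+1 & mono_clique c (~~ b) X]).
Proof.
move=> c_sym.
have extend x b' (X : {set T}) k (S' : {set T}) : x \in S' ->
    X \subset S' :&: nbrs c b' x ->
    #|X| = k -> mono_clique c b' X -> exists Y : {set T},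
    [/\ Y \subset S', #|Y| = k.+1 & mono_clique c b' Y].
  move=> xS XS Xk Xmono.
  have Xx y : y \in X -> y != x /\ c x y = b'.
    by move/(subsetP XS); rewrite !inE => /and3P[_ -> /eqP].
  exists (x |: X); split.
  - by rewrite subUset sub1set xS (subset_trans XS (subsetIl _ _)).
  - by rewrite cardsU1 Xk; case: (boolP (x \in X)) => // /Xx[]; rewrite eqxx.
  move=> y z /setU1P[->|yX] /setU1P[->|zX]; rewrite ?eqxx //.
  - by case: (Xx z).
  - by rewrite c_sym; case: (Xx y).
  by apply: Xmono.
elim: p q S => [|p IHp] q S.
  rewrite expn0 => /card_gt0P[x xS]; left.
  apply: (@extend x b set0 0 S) => //; rewrite ?sub0set ?cards0 //.
  by move=> y z; rewrite inE.
elim: q S => [|q IHq] S.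
  rewrite exp1n => /card_gt0P[x xS]; right.
  apply: (@extend x (~~ b) set0 0 S) => //; rewrite ?sub0set ?cards0 //.
  by move=> y z; rewrite inE.
move=> leS.
have /card_gt0P[x xS] : 0 < #|S| by apply: leq_trans leS; rewrite expn_gt0.
have split_S : #|S| = #|S :&: nbrs c b x| + #|S :&: nbrs c (~~ b) x| + 1.
  rewrite (cardsD1 x S) xS -(cardsID (nbrs c b x) (S :\ x)) addnC.
  congr (_ + _ + 1); apply: eq_card => y; rewrite !inE.
    by case: (y != x); rewrite ?andbF.
  by case: (y != x); case: (y \in S); case: (c x y); case: (b).
have le_pow : q.+2 ^ p + q.+1 ^ p.+1 <= q.+2 ^ p.+1.
  have : q.+1 ^ p <= q.+2 ^ p by case: (p) => // p'; rewrite leq_exp2r.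
  by rewrite !expnS; nia.
have [le1|lt1] := leqP (q.+2 ^ p) #|S :&: nbrs c b x|.
  have [[X [XS Xc Xm]]|[X [XS Xc Xm]]] := IHp _ _ le1.
    by left; apply: (extend x b X).
  by right; exists X; split=> //; apply: subset_trans XS (subsetIl _ _).
have le2 : q.+1 ^ p.+1 <= #|S :&: nbrs c (~~ b) x| by lia.
have [[X [XS Xc Xm]]|[X [XS Xc Xm]]] := IHq _ le2.
  by left; exists X; split=> //; apply: subset_trans XS (subsetIl _ _).
by right; apply: (extend x (~~ b) X).
Qed.

(** * Embedded copies and the Ramsey property *)

Lemma inj_into_set (W T : finType) (X : {set T}) :
  #|W| <= #|X| -> exists2 f : W -> T, injective f & forall w, f w \in X.
Proof.
move=> le; exists (fun w => enum_val (widen_ord le (enum_rank w))).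
  by move=> w w' /enum_val_inj/(congr1 val) /= /val_inj; apply: enum_rank_inj.
by move=> w; apply: enum_valP.
Qed.

Lemma clique_embeds (W T : finType) (e : rel W) (c : rel T) b (X : {set T}) :
  irreflexive e -> mono_clique c b X -> #|W| <= #|X| -> embeds e c b X.
Proof.
move=> e_irr Xm /inj_into_set[f f_inj fX]; exists f; split=> // x y exy.
by apply: Xm => //; apply: contraTneq exy => /f_inj->; rewrite e_irr.
Qed.

(** Carries the Ramsey property from ['I_r] to any sufficiently large set of vertices inside a
    coloured graph. *)
Lemma ramsey_embeds (W T : finType) (e : rel W) (c : rel T) r (S : {set T}) :
  ramsey_prop e r -> symmetric c -> r <= #|S| -> exists b, embeds e c b S.
Proof.
move=> /forallP er c_sym; rewrite -{1}[r]card_ord => /inj_into_set[g g_inj gS].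
have /implyP/(_ _)/existsP[] := er [ffun p => c (g p.1) (g p.2)].
  by apply/'forall_forallP => i j; rewrite !ffunE /= c_sym.
move=> b /existsP[f /andP[/injectiveP f_inj /'forall_forallP fe]].
exists b, (g \o f); split=> [||x y exy /=]; first exact: inj_comp.
  by move=> x; apply: gS.
by have /implyP/(_ exy)/eqP := fe x y; rewrite ffunE.
Qed.

Lemma embeds_ramsey (W : finType) (e : rel W) N :
  (forall c : rel 'I_N, symmetric c -> exists b, embeds e c b setT) ->
  ramsey_prop e N.
Proof.
move=> all_c; apply/forallP => c; apply/implyP => /'forall_forallP c_sym.
have [i j|b [f [f_inj _ fe]]] := all_c (fun i j => c (i, j)).
  exact/eqP.
apply/existsP; exists b; apply/existsP; exists [ffun x => f x].
apply/andP; split; first by apply/injectiveP => x y; rewrite !ffunE => /f_inj.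
apply/'forall_forallP => x y; rewrite !ffunE.
by apply/implyP => /fe->.
Qed.

(** The copy is completed by sending [v] to [x], whose edges to [S] all have colour [b]; [insub u]
    is [None] exactly when [u = v]. *)
Lemma del_embeds (V T : finType) (e : rel V) v (c : rel T) b x (S : {set T}) :
  symmetric e -> irreflexive e -> symmetric c -> S \subset nbrs c b x ->
  embeds (@del_vertex_rel V e v) c b S -> embeds e c b setT.
Proof.
move=> e_sym e_irr c_sym Sx [f [f_inj fS fe]].
have fx w : f w != x /\ c x (f w) = b.
  by have := subsetP Sx _ (fS w); rewrite inE => /andP[-> /eqP].
exists (fun u => if insub u is Some w then f w else x); split=> //.
  move=> u u'.
  case: insubP => [w _ <-|]; case: insubP => [w' _ <-|].
  - by move/f_inj->.
  - by move=> _ fwx; case: (fx w); rewrite fwx eqxx.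
  - by move=> _ fwx; case: (fx w'); rewrite fwx eqxx.
  by rewrite !negbK => /eqP-> /eqP->.
move=> u u'.
case: insubP => [w _ <-|]; case: insubP => [w' _ <-|].
- by move/fe.
- by move=> _ _; rewrite c_sym; case: (fx w).
- by move=> _ _; case: (fx w').
by rewrite !negbK => /eqP-> /eqP->; rewrite e_irr.
Qed.

(** * Greedy embedding of degenerate graphs *)

Lemma leq_card_bigcup (I T : finType) (P : {set I}) (F : I -> {set T}) :
  #|\bigcup_(i in P) F i| <= \sum_(i in P) #|F i|.
Proof.
elim/big_ind2: _ => [|m X p Y leX leY|//]; first by rewrite cards0.
exact: leq_trans (leq_card_setU _ _) (leq_add leX leY).
Qed.

(** Remove from [U] a vertex [x] with at most [d] neighbours in [U], embed the rest by induction,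
    then place [x]. The maps are total, so all conditions are relative to [U]. *)
Lemma degenerate_embeds (W T : finType) (e : rel W) (c : rel T) b
    (A : {set T}) d r :
  symmetric e -> irreflexive e -> symmetric c ->
  (forall U : {set W}, U != set0 ->
     exists2 x, x \in U & #|[set y in U | e x y]| <= d) ->
  {in A, forall w, #|A :&: nbrs c (~~ b) w| <= r} ->
  d * r + #|W| < #|A| -> embeds e c b A.
Proof.
move=> e_sym e_irr c_sym degen few lt_A.
have /card_gt0P[a aA] : 0 < #|A| by lia.
suff [f [f_inj fA fe]] : exists f : W -> T, [/\ {in [set: W] &, injective f},
    {in [set: W], forall x, f x \in A}
    & {in [set: W] &, forall x y, e x y -> c (f x) (f y) = b}].
  exists f; split=> [x y|x|x y]; first by apply: f_inj; rewrite inE.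
    by apply: fA; rewrite inE.
  by apply: fe; rewrite inE.
move: [set: W] => U; have [m] := ubnP #|U|; elim: m U => // m IHm U ltUm.
have [->|U_n0] := eqVneq U set0.
  by exists (fun=> a); split=> x; rewrite ?inE.
have [x xU deg_x] := degen _ U_n0.
have [|f [f_inj fA fe]] := IHm (U :\ x).
  by rewrite (cardsD1 x U) xU in ltUm; lia.
set N := [set y in U | e x y] in deg_x.
have NU y : y \in N -> y \in U :\ x.
  by rewrite !inE => /andP[-> exy]; rewrite andbT; apply: contraTneq exy => ->;
     rewrite e_irr.
(* Forbidden images of [x]: those already used, and those joined in the wrong colour to the image of
   one of the at most [d] neighbours. *)
set bad := f @: (U :\ x) :|: \bigcup_(y in N) (A :&: nbrs c (~~ b) (f y)).
have bad_card : #|bad| <= #|W| + d * r.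
  apply: leq_trans (leq_card_setU _ _) (leq_add _ _).
    by apply: leq_trans (leq_imset_card _ _) (max_card _).
  apply: leq_trans (leq_mul deg_x (leqnn r)).
  apply: leq_trans (leq_card_bigcup _ _) _.
  rewrite -sum_nat_const; apply: leq_sum => y yN.
  by apply: few; apply/fA/NU.
have /card_gt0P[z] : 0 < #|A :\: bad|.
  by have := cardsID bad A; have := subset_leq_card (subsetIr A bad); lia.
rewrite inE => /andP[z_ok zA].
have z_new y : y \in U :\ x -> f y != z.
  move=> yU; apply: contraNneq z_ok => <-.
  by rewrite inE imset_f.
have z_col y : y \in U -> e x y -> c (f y) z = b.
  move=> yU exy; have yN : y \in N by rewrite inE yU.
  apply: contraNeq z_ok => cyz; rewrite inE; apply/orP; right.
  apply/bigcupP; exists y => //; rewrite !inE zA eq_sym z_new ?NU //=.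
  by move: cyz; case: (c _ _); case: (b).
exists (fun y => if y == x then z else f y); split.
- move=> y y' yU y'U; have := z_new y; have := z_new y'; have := f_inj y y'.
  rewrite !inE yU y'U !andbT; do 2![case: eqVneq => [->|_]] => //= inj ne ne' E.
  + by have := ne isT; rewrite E eqxx.
  + by have := ne' isT; rewrite E eqxx.
  + exact: inj.
- by move=> y yU; case: eqVneq => // yx; apply: fA; rewrite !inE yx.
move=> y y' yU y'U.
have := fe y y'; rewrite !inE yU y'U !andbT.
do 2![case: eqVneq => [->|_]] => //=; first by rewrite e_irr.
- by move=> _ exy'; rewrite c_sym z_col.
- by move=> _ eyx; rewrite z_col // e_sym.
by move=> + eyy'; apply.
Qed.

(** * Random colourings and an exponential lower bound *)

(** These [g] are the functions with default value [b] supported on the complement of [E]. *)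
Lemma card_fixed_on (X : finType) (E : {set X}) b :
  #|[set g : {ffun X -> bool} | [forall x in E, g x == b]]| = 2 ^ (#|X| - #|E|).
Proof.
have -> : #|X| - #|E| = #|~: E| by rewrite [RHS]cardsCs setCK.
rewrite -card_bool -(card_pffun_on b (~: E) predT).
apply: eq_card => g; rewrite inE; apply/'forall_implyP/pffun_onP.
  move=> gE; split=> [|x _] //; apply/subsetP => x; rewrite !inE.
  by apply: contra => xE; apply: gE.
case=> /subsetP supp _ x xE; apply: contraLR xE => gx.
by have := supp x; rewrite !inE => ->.
Qed.

(** Summing degrees counts ordered pairs, and an image edge arises from at most two of them,
    [(x, y)] and [(y, x)]. *)
Lemma card_edge_image (W T : finType) (e : rel W) (f : W -> T) d :
  injective f -> (forall x, d <= #|[set y | e x y]|) ->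
  #|W| * d <= #|[set [set f p.1; f p.2] | p in [set p : W * W | e p.1 p.2]]| * 2.
Proof.
move=> f_inj deg; set P := [set p | _].
apply: (@leq_trans #|P|).
  have -> : #|P| = \sum_x #|[set y | e x y]|.
    rewrite -sum1_card (eq_bigl (fun p : W * W => xpredT p.1 && e p.1 p.2)).
      rewrite -(pair_big_dep xpredT e (fun _ _ => 1)).
      apply: eq_bigr => x _; rewrite -sum1_card.
      by apply: eq_bigl => y; rewrite inE.
    by move=> p; rewrite inE.
  by rewrite -sum_nat_const; apply: leq_sum => x _; apply: deg.
apply: card_le_fibers => -[x y] _ /=.
apply: (@leq_trans #|[set (x, y); (y, x)]|); last by rewrite cards2; case: eqP.
apply: subset_leq_card; apply/subsetP => -[x' y'].
rewrite !inE /= => /andP[_ /eqP E].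
have : f x' \in [set f x; f y] by rewrite -E !inE eqxx.
have : f y' \in [set f x; f y] by rewrite -E !inE eqxx orbT.
have : f x \in [set f x'; f y'] by rewrite E !inE eqxx.
have : f y \in [set f x'; f y'] by rewrite E !inE eqxx orbT.
rewrite !inE !(eqtype.inj_eq f_inj) !xpair_eqE.
by rewrite (eq_sym x x') (eq_sym x y') (eq_sym y x') (eq_sym y y');
   do 4!case: eqP => //=.
Qed.

(* Union bound over the colour and the injection: a uniformly random colouring
   of the edges makes a given copy monochromatic with probability at most
   [2 ^ (1 - #edges)]. *)
Lemma ramsey_lower (W : finType) (e : rel W) m M :
  irreflexive e -> 0 < #|W| -> (forall x, m.+1 * 2 <= #|[set y | e x y]|) ->
  M <= 2 ^ m -> ~~ ramsey_prop e M.
Proof.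
move=> e_irr /card_gt0P[x0 _] deg leM; apply/negP => /forallP er.
have W_gt1 : 1 < #|W|.
  have /card_gt0P[y] : 0 < #|[set y | e x0 y]| by apply: leq_trans (deg x0).
  rewrite inE => exy; apply/card_gt1P; exists x0, y; split=> //.
  by apply: contraTneq exy => ->; rewrite e_irr.
pose img (f : {ffun W -> 'I_M}) :=
  [set [set f p.1; f p.2] | p in [set p : W * W | e p.1 p.2]].
(* Colours are given to all subsets of ['I_M] and read off at the pairs: symmetry is automatic, and
   the extra sets scale every count alike. *)
pose Z (bf : bool * {ffun W -> 'I_M}) :=
  [set g : {ffun {set 'I_M} -> bool} | [forall X in img bf.2, g X == bf.1]].
pose D := [set bf : bool * {ffun W -> 'I_M} | injectiveb bf.2].
pose P := #|{set 'I_M}|.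
have cover : [set: {ffun {set 'I_M} -> bool}] \subset \bigcup_(bf in D) Z bf.
  apply/subsetP => g _.
  have /implyP/(_ _)/existsP[] := er [ffun p => g [set p.1; p.2]].
    by apply/'forall_forallP => i j; rewrite !ffunE /= setUC.
  move=> b /existsP[f /andP[f_inj /'forall_forallP fe]].
  apply/bigcupP; exists (b, f); first by rewrite inE.
  rewrite inE; apply/'forall_implyP => Z0 /imsetP[[x y]].
  rewrite inE /= => exy ->{Z0}.
  by have /implyP/(_ exy) := fe x y; rewrite ffunE.
have img_card bf : bf \in D -> #|W| * m.+1 <= #|img bf.2|.
  rewrite inE => /injectiveP inj; have := card_edge_image inj deg.
  by rewrite -/(img bf.2); lia.
have Z_card bf : bf \in D -> #|Z bf| <= 2 ^ (P - #|W| * m.+1).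
  by move=> bfD; rewrite card_fixed_on leq_exp2l // leq_sub2l // img_card.
have D_card : #|D| <= 2 ^ (#|W| * m).+1.
  apply: leq_trans (max_card _) _.
  rewrite card_prod card_bool card_ffun card_ord expnS leq_mul2l /= mulnC expnM.
  by rewrite leq_exp2r // ltnW.
have := subset_leq_card cover; rewrite cardsT card_ffun card_bool -/P.
apply/negP; rewrite -ltnNge; apply: leq_ltn_trans (leq_card_bigcup _ _) _.
have [->|/set0Pn[bf bfD]] := eqVneq D set0; first by rewrite big_set0 expn_gt0.
have leP : #|W| * m.+1 <= P.
  by apply: leq_trans (img_card _ bfD) (max_card _).
apply: (@leq_ltn_trans (#|D| * 2 ^ (P - #|W| * m.+1))).
  by rewrite -sum_nat_const; apply: leq_sum => ? /Z_card.
apply: leq_ltn_trans (leq_mul D_card (leqnn _)) _.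
(* The exponent is [P + 1 - #|W|], below [P] by [W_gt1]; the 1 pays for the choice of colour. *)
by rewrite -expnD ltn_exp2l //; move: leP; rewrite mulnS; lia.
Qed.

(** * Large cliques when one colour is sparse *)

Lemma sum_card_setI_nbrs (T : finType) (c : rel T) b (X Y : {set T}) :
  symmetric c ->
  \sum_(x in X) #|Y :&: nbrs c b x| = \sum_(y in Y) #|X :&: nbrs c b y|.
Proof.
move=> c_sym.
have count Z x : #|Z :&: nbrs c b x| = \sum_(y in Z) ((y != x) && (c x y == b)).
  rewrite -sum1_card [LHS]big_mkcond [RHS]big_mkcond /=.
  by apply: eq_bigr => y _; rewrite !inE; case: (y \in Z) => //=; case: (_ && _).
rewrite (eq_bigr _ (fun x _ => count Y x)) exchange_big /=.
apply: eq_bigr => y _; rewrite count; apply: eq_bigr => x _.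
by rewrite eq_sym c_sym.
Qed.

(* A maximal clique [I] of colour [b] is too small to absorb the edges leaving
   it, so many vertices have few neighbours of the other colour in [I], and
   many of those share the same set [X] of such neighbours.  Among them a
   [b]-clique larger than [X] could be exchanged for [X], hence Erdős–Szekeres
   yields a large clique of the other colour. *)
Lemma sparse_clique (T : finType) (c : rel T) b (A : {set T}) n r t :
  symmetric c ->
  {in A, forall w, #|A :&: nbrs c (~~ b) w| <= r} ->
  n * r + (n + n.+1 ^ (2 * t)) * t.+1 <= #|A| * t.+1 ->
  (exists X : {set T}, [/\ X \subset A, n <= #|X| & mono_clique c b X]) \/
  (exists X : {set T}, [/\ X \subset A, n < #|X| & mono_clique c (~~ b) X]).
Proof.
move=> c_sym few large.
pose cliqueb (X : {set T}) := (X \subset A) &&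
  [forall x in X, forall y in X, (x != y) ==> (c x y == b)].
have cliqueP (X : {set T}) :
    reflect (X \subset A /\ mono_clique c b X) (cliqueb X).
  apply: (iffP andP) => -[XA Xm]; split=> //.
    move=> x y xX yX xy.
    by have /forall_inP/(_ x xX)/forall_inP/(_ y yX)/implyP/(_ xy)/eqP := Xm.
  by apply/forall_inP => x xX; apply/forall_inP => y yX; apply/implyP => xy;
     apply/eqP; apply: Xm.
have cl0 : cliqueb set0.
  by apply/cliqueP; split; [apply: sub0set | move=> x y; rewrite inE].
case: (arg_maxnP (fun X : {set T} => #|X|) cl0) => I /cliqueP[IA I_mono] I_max.
have [leI|ltI] := leqP n #|I|; first by left; exists I.
have I_nonbr i w : i \notin nbrs c (~~ b) w -> i != w -> c w i = b.
  rewrite !inE => + iw; rewrite iw /=; case: (c w i); by case: (b).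
pose nb w := I :&: nbrs c (~~ b) w.
pose bad := [set w in A | t < #|nb w|].
pose good := A :\: (bad :|: I).
(* Double counting of the edges of colour [~~ b] between [I] and [A]: [I] has fewer than [n]
   vertices, each on at most [r] such edges. *)
have bad_card : #|bad| * t.+1 <= n * r.
  apply: (@leq_trans (\sum_(w in bad) #|nb w|)).
    by rewrite -sum_nat_const; apply: leq_sum => w; rewrite inE => /andP[].
  apply: (@leq_trans (\sum_(w in A) #|nb w|)).
    rewrite big_mkcond [X in _ <= X]big_mkcond; apply: leq_sum => w _.
    by rewrite inE; case: (w \in A); case: (t < _).
  rewrite sum_card_setI_nbrs //.
  apply: (@leq_trans (#|I| * r)); last by rewrite leq_mul2r ltnW ?orbT.
  by rewrite -sum_nat_const; apply: leq_sum => i iI;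
     apply: few; apply: (subsetP IA).
have good_card : n.+1 ^ (2 * t) <= #|good|.
  have := cardsID (bad :|: I) A; rewrite -/good => splitA.
  have := subset_leq_card (subsetIr A (bad :|: I)).
  have := (leq_card_setU bad I).1 => leU leI.
  rewrite -(leq_pmul2r (ltn0Sn t)).
  have : #|A| * t.+1 <= (#|bad| + n + #|good|) * t.+1 by rewrite leq_mul2r; lia.
  by rewrite !mulnDl in large *; lia.
have goodP w : w \in good -> [/\ w \in A, #|nb w| <= t & w \notin I].
  by rewrite !inE negb_or => /andP[/andP[+ ->] wA]; rewrite wA -leqNgt.
(* Pigeonhole: [nb] takes at most [n.+1 ^ t] values on [good], which has at least the square of that
   many elements. *)
have [X [X_I Xt fibre]] : exists X : {set T}, [/\ X \subset I, #|X| <= t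
    & n.+1 ^ t <= #|[set w in good | nb w == X]|].
  have [/forall_inP fib|] := boolP [forall w in good,
      #|[set w' in good | nb w' == nb w]| < n.+1 ^ t].
    suff : #|good| < n.+1 ^ (2 * t) by rewrite ltnNge good_card.
    have le_img : #|nb @: good| <= n.+1 ^ t.
      apply: (@leq_trans (#|I|.+1 ^ t)); last first.
        by case: (t) => // u; rewrite leq_exp2r //; apply: ltnW.
      apply: leq_trans (card_small_subsets I t); apply: subset_leq_card.
      by apply/subsetP => _ /imsetP[w /goodP[_ wt _] ->]; rewrite inE subsetIl.
    have K_gt0 : 0 < n.+1 ^ t by rewrite expn_gt0.
    apply: (@leq_ltn_trans (n.+1 ^ t * (n.+1 ^ t).-1)).
      apply: leq_trans (leq_mul le_img (leqnn _)).
      by apply: card_le_fibers => w wg; rewrite -ltnS prednK //; apply: fib.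
    by rewrite mul2n -addnn expnD ltn_pmul2l // ltn_predL.
  rewrite negb_forall_in => /exists_inP[w /goodP[_ wt _]]; rewrite -leqNgt => fib.
  by exists (nb w); split=> //; apply: subsetIl.
set Y := [set w in good | nb w == X] in fibre.
have YP w : w \in Y -> [/\ w \in A, w \notin I & nb w = X].
  by rewrite inE => /andP[/goodP[? _ ?] /eqP].
have YA : Y \subset A by apply/subsetP => w /YP[].
(* With [p = t] and [q = n]: either a [b]-clique of size [t.+1], larger than [X], or the desired
   clique of size [n.+1]. *)
have [[Q [QY Qc Qm]]|[Q [QY Qc Qm]]] := erdos_szekeres b c_sym fibre; last first.
  by right; exists Q; rewrite Qc; split=> //; apply: subset_trans YA.
have QI : [disjoint Q & I].
  rewrite disjoint_subset; apply/subsetP => w wQ.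
  by have [_ + _] := YP w (subsetP QY _ wQ); rewrite inE.
have cross i w : i \in I :\: X -> w \in Q -> c w i = b.
  rewrite inE => /andP[iX iI] wQ; have [wA wI nbw] := YP w (subsetP QY _ wQ).
  apply: (I_nonbr) => //; last by apply: contraNneq wI => <-.
  by move: iX; rewrite -nbw inE iI.
(* Exchanging [X] for [Q] yields a clique larger than [I], against maximality. *)
have : cliqueb (I :\: X :|: Q).
  apply/cliqueP; split.
    by rewrite subUset (subset_trans (subsetDl _ _) IA) (subset_trans QY YA).
  move=> x y /setUP[xI|xQ] /setUP[yI|yQ] xy.
  - by move: xI yI; rewrite !inE => /andP[_ xI] /andP[_ yI]; apply: I_mono.
  - by rewrite c_sym cross.
  - exact: cross.
  - exact: Qm.
move/I_max; rewrite /= cardsU cardsD (setIidPr X_I) Qc.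
have -> : (I :\: X) :&: Q = set0.
  apply/setP => w; rewrite !inE; apply: contraTF QI => /andP[/andP[_ wI] wQ].
  by apply/pred0Pn; exists w; rewrite /= wQ wI.
by rewrite cards0; have := subset_leq_card X_I; lia.
Qed.

(** * Monotonicity, existence and minimum degree for the Ramsey property *)

Lemma ramsey_prop_sub (W W' : finType) (e : rel W) (e' : rel W') (g : W' -> W) r :
  injective g -> (forall x y, e' x y -> e (g x) (g y)) ->
  ramsey_prop e r -> ramsey_prop e' r.
Proof.
move=> g_inj ge er; apply: embeds_ramsey => c c_sym.
have [|b [f [f_inj _ fe]]] := ramsey_embeds (S := setT) er c_sym.
  by rewrite cardsT card_ord.
exists b, (f \o g); split=> [|x|x y /ge/fe] //; exact: inj_comp.
Qed.

Lemma ramsey_ge_card (W : finType) (e : rel W) r : ramsey_prop e r -> #|W| <= r.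
Proof.
move=> er.
have [||b [f [f_inj _ _]]] :=
    ramsey_embeds (c := fun _ _ : 'I_r => true) (S := setT) er.
- by [].
- by rewrite cardsT card_ord.
by rewrite -[r]card_ord; apply: leq_card f_inj.
Qed.

Lemma ramsey_exists (W : finType) (e : rel W) :
  irreflexive e -> exists N, ramsey_prop e N.
Proof.
move=> e_irr; exists (#|W|.+1 ^ #|W|); apply: embeds_ramsey => c c_sym.
have leT : #|W|.+1 ^ #|W| <= #|[set: 'I_(#|W|.+1 ^ #|W|)]|.
  by rewrite cardsT card_ord.
have [[X [_ Xc Xm]]|[X [_ Xc Xm]]] := erdos_szekeres true c_sym leT.
  exists true; apply: embedsS (subsetT X) _.
  by apply: clique_embeds => //; rewrite Xc.
exists false; apply: embedsS (subsetT X) _.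
by apply: clique_embeds => //; rewrite Xc.
Qed.

(** The subgraph induced on [U] inherits the Ramsey property, which random colourings refute on
    [2 ^ m] or fewer vertices. *)
Lemma min_degree_ramsey (W : finType) (e : rel W) (U : {set W}) m r :
  irreflexive e -> U != set0 ->
  {in U, forall x, m.+1 * 2 <= #|[set y in U | e x y]|} ->
  ramsey_prop e r -> 2 ^ m < r.
Proof.
move=> e_irr /set0Pn[x0 x0U] deg er; rewrite ltnNge; apply/negP => le_r.
pose eU : rel {x : W | x \in U} := fun x y => e (val x) (val y).
suff /negP : ~~ ramsey_prop eU r.
  by apply; apply: (ramsey_prop_sub val_inj _ er).
apply: ramsey_lower le_r => [x||x]; first exact: e_irr.
  by apply/card_gt0P; exists (Sub x0 x0U).
apply: leq_trans (deg _ (valP x)) _.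
apply: leq_trans (leq_imset_card val _); apply: subset_leq_card.
apply/subsetP => y; rewrite inE => /andP[yU exy].
by apply/imsetP; exists (Sub y yU); rewrite ?inE.
Qed.

(** * The bound in integer form *)

(** Here [l] is an upper bound for [log n] and [k] the factor of order [sqrt (n log n)], which keeps
    real numbers out of the combinatorics. *)
Lemma ramsey_del_vertex (V : finType) (e : rel V) (v : V) n l k r :
  1 < n -> #|V| = n.+1 -> symmetric e -> irreflexive e ->
  n < 2 ^ l -> 100 * (n * l) <= k * k ->
  ramsey_prop (@del_vertex_rel V e v) r -> ramsey_prop e (k * r).
Proof.
move=> n_gt1 cardV e_sym e_irr n_lt le_k Hr.
set H := @del_vertex_rel V e v in Hr.
have H_irr : irreflexive H by move=> x; apply: e_irr.
have H_sym : symmetric H by move=> x y; apply: e_sym.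
have cardH : #|del_vertex_type V v| = n.
  by rewrite card_sig cardC1 cardV.
have n_le_r : n <= r by rewrite -cardH; apply: ramsey_ge_card Hr.
have l_gt1 : 1 < l.
  by case: (l) n_lt => [|[|//]]; rewrite ?expn0 ?expn1; lia.
have k_ge : 20 <= k by nia.
apply: embeds_ramsey => c c_sym; apply: NNPP => no.
have noG b : ~ embeds e c b setT by move=> G; apply: no; exists b.
have N_gt0 : 0 < k * r by nia.
pose x0 := Ordinal N_gt0.
have [b A_large] : exists b, k * r <= 2 * #|nbrs c b x0| + 1.
  have : k * r = (#|nbrs c true x0| + #|nbrs c false x0|).+1.
    rewrite -[LHS]card_ord -cardsT (cardsD1 x0) inE add1n.
    rewrite -(cardsID (nbrs c true x0) (_ :\ _)).
    congr ((_ + _).+1); apply: eq_card => y; rewrite !inE.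
      by case: (y != x0).
    by case: (y != x0); case: (c x0 y).
  have [?|?] := leqP #|nbrs c true x0| #|nbrs c false x0|.
    by exists false; lia.
  by exists true; lia.
set A := nbrs c b x0 in A_large.
have noH : ~ embeds H c b A.
  by move=> /del_embeds-/(_ x0 e_sym e_irr c_sym (subxx _)) /noG.
(* Otherwise [Hr] gives a copy of [H] among these neighbours of [w]: colour [b] contradicts [noH],
   and in the other colour [w] extends it to [G]. *)
have few : {in A, forall w, #|A :&: nbrs c (~~ b) w| <= r}.
  move=> w wA; rewrite leqNgt; apply/negP => /ltnW.
  move=> /(ramsey_embeds Hr c_sym)[b' Hb'].
  have [eb|eb] := eqVneq b' b.
    by apply: noH; rewrite -eb; apply: embedsS Hb'; apply: subsetIl.
  have eb' : b' = ~~ b by move: eb; case: (b) (b') => [] [].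
  rewrite eb' in Hb'; apply: (noG (~~ b)).
  by apply: (del_embeds (v := v) (x := w)) Hb'; rewrite ?subsetIr.
(* From [4 * m + 5 <= k] it follows that [#|A|] exceeds [(2 * m + 2) * r], hence also the
   [(2 * m + 1) * r + n] that greedy embedding requires. *)
pose m := (k - 5) %/ 4.
have [m_ub m_lb] : 4 * m + 5 <= k /\ k <= 4 * m + 8 by rewrite /m; lia.
have r_large : 2 ^ m < r.
  have [/forallP degen|] := boolP [forall U : {set del_vertex_type V v},
      (U != set0) ==> [exists x in U, #|[set y in U | H x y]| <= m * 2 + 1]].
    case: noH; apply: (degenerate_embeds (d := m * 2 + 1) (r := r)) => //.
      by move=> U /(implyP (degen U))/exists_inP.
    by rewrite cardH; nia.
  rewrite negb_forall => /existsP[U]; rewrite negb_imply negb_exists_in.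
  move=> /andP[U_n0 /forall_inP deg]; apply: (min_degree_ramsey H_irr U_n0) Hr.
  by move=> x xU; have := deg x xU; rewrite -ltnNge; lia.
(* Large enough that [n * r] is below [k * r * t.+1 / 4], about half of [#|A| * t.+1]; small enough
   that [n.+1 ^ (2 * t) <= 2 ^ m < r]. *)
pose t := (4 * n) %/ k.
have tk : t * k <= 4 * n by apply: leq_trunc_div.
have tk' : 4 * n < k * t.+1 by rewrite [k * _]mulnC /t ltn_ceil //; lia.
have tl_m : l * (2 * t) <= m.
  rewrite leqNgt; apply/negP => lt_m.
  have : k <= 8 * (t * l) + 4 by nia.
  have : t * k * l <= 4 * n * l by rewrite leq_mul2r tk orbT.
  by nia.
have pow_r : n.+1 ^ (2 * t) <= r.
  apply: leq_trans (ltnW r_large).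
  apply: leq_trans (_ : 2 ^ (l * (2 * t)) <= _); last by rewrite leq_exp2l.
  by rewrite (expnM 2 l); case: (2 * t) => // u; rewrite leq_exp2r.
have [|[X [XA Xn Xm]]|[X [XA Xn Xm]]] := @sparse_clique _ c b A n r t c_sym few.
- have : (n + n.+1 ^ (2 * t)) * t.+1 <= 2 * r * t.+1 by rewrite leq_mul2r; lia.
  have : k * r + 8 * r <= 4 * #|A| by nia.
  have : 4 * n * r <= k * t.+1 * r by rewrite leq_mul2r ltnW ?orbT.
  by nia.
- apply: noH; apply: embedsS XA _.
  by apply: clique_embeds => //; rewrite cardH.
apply: (noG (~~ b)); apply: embedsS (subsetT X) _.
by apply: clique_embeds => //; rewrite cardV.
Qed.

(** * Ramsey numbers and real logarithms *)

Lemma ramsey_number_le (V : finType) (e : rel V) N :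
  ramsey_prop e N -> ramsey_number e <= N.
Proof.
rewrite /ramsey_number => eN.
case: ClassicalEpsilon.excluded_middle_informative => // h.
by case: ex_minnP => m _; apply.
Qed.

(** By [ramsey_exists] the default value 0 is never taken. *)
Lemma ramsey_numberP (V : finType) (e : rel V) :
  irreflexive e -> ramsey_prop e (ramsey_number e).
Proof.
move=> /ramsey_exists eN; rewrite /ramsey_number.
case: ClassicalEpsilon.excluded_middle_informative => // h.
by case: ex_minnP.
Qed.

Lemma trunc_log2_le_ln n : 0 < n ->
  (INR (trunc_log 2 n) * ln 2 <= ln (INR n))%R.
Proof.
move=> n_gt0.
have INR_exp m : INR (2 ^ m) = pow 2 m.
  by elim: m => // m IHm; rewrite expnS mult_INR IHm.
rewrite -ln_pow; last lra.
have le2n : (pow 2 (trunc_log 2 n) <= INR n)%R.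
  by rewrite -INR_exp; apply/le_INR/leP/trunc_logP.
by case: le2n => [/ln_increasing lt|->]; [apply/Rlt_le/lt/pow_lt; lra | lra].
Qed.

Theorem theorem1p3 :
  exists C : R, (0 < C)%R /\
    forall (n : nat) (V : finType) (e : rel V) (v : V),
      (2 <= n)%N -> #|V| = n.+1 -> symmetric e -> irreflexive e ->
      (INR (ramsey_number e)
        <= C * sqrt (INR n * (ln (INR n) / ln 2))
             * INR (ramsey_number (@del_vertex_rel V e v)))%R.
Proof.
(* The factor [k] will be [15 * s] rounded up, at most [16 * s] since [s >= 1]. *)
exists 16%R; split=> [|n V e v n_gt1 cardV e_sym e_irr]; first lra.
set L := (ln (INR n) / ln 2)%R; set s := sqrt _.
have ln2_gt0 : (0 < ln 2)%R by have := ln_lt_2; lra.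
set t := trunc_log 2 n.
have t_le : (INR t <= L)%R.
  apply: (Rmult_le_reg_r (ln 2)) => //.
  rewrite /L /Rdiv Rmult_assoc Rinv_l ?Rmult_1_r; last lra.
  by apply: trunc_log2_le_ln; lia.
have t_ge1 : (1 <= INR t)%R.
  by apply: (le_INR 1); apply/leP; rewrite trunc_log_gt0.
have n_ge2 : (2 <= INR n)%R by apply: (le_INR 2); apply/leP.
have ss : (s * s = INR n * L)%R by apply: sqrt_sqrt; nra.
have s_ge0 : (0 <= s)%R by apply: sqrt_pos.
have s_ge1 : (1 <= s)%R by nra.
have [k_gt k_le] := archimed (15 * s).
set k := Z.to_nat (up (15 * s)).
have kE : INR k = IZR (up (15 * s)).
  rewrite INR_IZR_INZ Z2Nat.id //; apply: le_IZR; lra.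
(* Here [l] is [t.+1], as [n < 2 ^ t.+1]. From [1 <= t <= L] follows [t.+1 <= 2 * L], while [k * k]
   exceeds [225 * n * L]. *)
have k_large : 100 * (n * t.+1) <= k * k.
  apply/leP/INR_le; rewrite !mult_INR kE (S_INR t).
  have -> : INR 100 = 100%R by rewrite INR_IZR_INZ.
  by nra.
have : ramsey_prop e (k * ramsey_number (@del_vertex_rel V e v)).
  apply: (ramsey_del_vertex n_gt1 cardV e_sym e_irr _ k_large).
    exact: trunc_log_ltn.
  by apply: ramsey_numberP => x; apply: e_irr.
move=> /ramsey_number_le/leP/le_INR; rewrite mult_INR kE => le.
apply: Rle_trans le _; apply: Rmult_le_compat_r; first exact: pos_INR.
lra.
Qed.
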